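(* Consider the following Jordan webs in $\mathbb{S}^4$, written as spans of quadratic forms in $a,b,c,d$: $A^{(1)}_{0,0,0,1}=\langle a^2,b^2,c^2,d^2\rangle$, $A^{(2)}_{0,1,0,1}=\langle a^2,b^2,cd,c^2\rangle$, $A^{(3)}_{0,1,0,1}=\langle ab,a^2,cd,c^2\rangle$, $A^{(4)}_{1,0,0,1}=\langle a^2,2bd+c^2,bc,b^2\rangle$, $A^{(5)}_{0,0,0,1}=\langle ad+bc,2ac+b^2,ab,a^2\rangle$, $B^{(1)}_{2,1}=\langle a^2+b^2,c^2,d^2,cd\rangle$, $C^{(1)}_1=\langle a^2+b^2,c^2+d^2,ac+bd,ad-bc\rangle$, $E^{(1)}_{4,1}=\langle 2ac+d^2,b^2,ab,a^2\rangle$, $E^{(1)}_{4,2}=\langle ac,b^2+d^2,ab,a^2\rangle$, $E^{(2)}_4=\langle ab,cd,ac,a^2\rangle$, $E^{(3)}_4=\langle 2ac+b^2+d^2,ad,ab,a^2\rangle$, $F_4=\langle ad+bc,a^2,b^2,ab\rangle$. Then the following degenerations exist: (a) $A^{(1)}_{0,0,0,1}\to A^{(2)}_{0,1,0,1}$; (b) $A^{(2)}_{0,1,0,1}\to A^{(3)}_{0,1,0,1}$; (c) $A^{(2)}_{0,1,0,1}\to A^{(4)}_{1,0,0,1}$; (d) $A^{(3)}_{0,1,0,1}\to A^{(5)}_{0,0,0,1}$; (e) $A^{(4)}_{1,0,0,1}\to A^{(5)}_{0,0,0,1}$; (f) $A^{(5)}_{0,0,0,1}\to E^{(3)}_4$;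 (g) $A^{(5)}_{0,0,0,1}\to F_4$; (h) $B^{(1)}_{2,1}\to E^{(1)}_{4,1}$; (i) $C^{(1)}_1\to F_4$; (j) $E^{(1)}_{4,1}\to F_4$; (k) $E^{(1)}_{4,2}\to E^{(2)}_4$; (l) $E^{(2)}_4\to E^{(3)}_4$.
   Context: $\mathbb{S}^4$ is the space of complex symmetric $4\times 4$ matrices. A Jordan web is a $4$-dimensional subspace $\mathcal{L}$ containing an invertible matrix $U$ and closed under $X\bullet_UY=\frac12(XU^{-1}Y+YU^{-1}X)$. A subspace $\mathcal{L}\subseteq\mathbb{S}^4$ is identified with the space of quadratic forms $(a,b,c,d)\mathcal{L}(a,b,c,d)^\top$; $\langle q_1,\dots,q_4\rangle$ denotes the linear span of the forms, i.e. the span of the corresponding symmetric matrices. Degeneration of Jordan spaces: if $\mathcal{L},\mathcal{L}'\subseteq\mathbb{S}^n$ are Jordan spaces of dimension $m$ with bases $X_1,\dots,X_m$ and $X_1',\dots,X_m'$, then $\mathcal{L}$ degenerates to $\mathcal{L}'$, written $\mathcal{L}\to\mathcal{L}'$, if there exist $P\in\mathrm{GL}_n(\mathbb{C}[t^{\pm1}])$ and $Q\in\mathrm{GL}_m(\mathbb{C}[t^{\pm1}])$ such that the entries of $(Y_1,\dots,Y_m):=(PX_1P^\top,\dots,PX_mP^\top)Q$ are matrices with coefficients in $\mathbb{C}[t]$ and $X_i'=\lim_{t\to0}Y_i$ for all $i$. *)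

(* Defs.v *)
From HB Require Import structures.
From mathcomp Require Import all_boot all_order all_algebra complex.
From mathcomp Require Import all_classical all_reals all_analysis.

Set Implicit Arguments.
Unset Strict Implicit.
Unset Printing Implicit Defensive.

Import Order.TTheory GRing.Theory Num.Theory.
Import numFieldNormedType.Exports.

Local Open Scope classical_set_scope.
Local Open Scope ring_scope.

(* Registers R[i] as a numFieldType, which carries the topology of the
   modulus; limits in R[i] are taken for this topology. *)
Definition CC (R : realType) : numFieldType := R[i].

Section JordanSpaces.
Variable (K : numFieldType) (n : nat).

Definition jordan_prod (U X Y : 'M[K]_n) : 'M[K]_n :=
  2^-1 *: (X *m invmx U *m Y + Y *m invmx U *m X).

Definition jordan_space (L : {vspace 'M[K]_n}) : Prop :=
  (forall X, X \in L -> X^T = X) /\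
  exists U, [/\ U \in L, U \in unitmx &
    forall X Y, X \in L -> Y \in L -> jordan_prod U X Y \in L].

End JordanSpaces.

Section Degeneration.
Variable K : numFieldType.

(* K[t, t^-1] is realized inside the fraction field K(t): x is a Laurent
   polynomial when it is a polynomial divided by a power of t. *)
Definition is_laurent (x : {fraction {poly K}}) : Prop :=
  exists (p : {poly K}) (k : nat), x = tofrac p / tofrac 'X^k.

(* GL_n(K[t, t^-1]): both the matrix and its inverse have Laurent entries. *)
Definition GL_laurent n (P : 'M[{fraction {poly K}}]_n) : Prop :=
  [/\ P \in unitmx, forall i j, is_laurent (P i j)
    & forall i j, is_laurent (invmx P i j)].

Definition const_frac (c : K) : {fraction {poly K}} := tofrac c%:P.

(* L -> L' for m-dimensional Jordan spaces of symmetric n x n matrices.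
   Changing the bases X and X' only multiplies Q by constant invertible
   matrices, so quantifying existentially over them loses nothing. The matrix
   Y j has coefficients in K[t], and (Y_1, ..., Y_m) is the row
   (P X_1 P^T, ..., P X_m P^T) multiplied by Q on the right. *)
Definition degenerates n m (L L' : {vspace 'M[K]_n}) : Prop :=
  [/\ jordan_space L, jordan_space L' &
  exists X X' : m.-tuple 'M[K]_n,
  exists (P : 'M[{fraction {poly K}}]_n) (Q : 'M[{fraction {poly K}}]_m)
         (Y : 'I_m -> 'M[{poly K}]_n),
  [/\ basis_of L X /\ basis_of L' X',
      GL_laurent P,
      GL_laurent Q,
      forall j, map_mx (@tofrac {poly K}) (Y j) =
        \sum_(i < m) Q i j *: (P *m map_mx const_frac (tnth X i) *m P^T)
    & forall j,
        map_mx (fun p : {poly K} => p.[t]) (Y j) @[t --> (0 : K)^'] -->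
        tnth X' j]].

End Degeneration.

(* The symmetric matrix of the quadratic form x_i x_j. *)
Definition monom (K : numFieldType) n (i j : 'I_n) : 'M[K]_n :=
  2^-1 *: (delta_mx i j + delta_mx j i).

Lemma monom_sym (K : numFieldType) n (i j : 'I_n) :
  (monom K i j)^T = monom K i j.
Proof. by rewrite /monom linearZ linearD /= !trmx_delta addrC. Qed.

Lemma qform_monom (K : numFieldType) n (i j : 'I_n) (x : 'rV[K]_n) :
  (x *m monom K i j *m x^T) 0 0 = x 0 i * x 0 j.
Proof.
have delta_form (k l : 'I_n) : (x *m delta_mx k l *m x^T) 0 0 = x 0 k * x 0 l.
  rewrite mxE.
  rewrite (bigD1 l) //= big1 => [|p pl]; last first.
    rewrite !mxE big1 ?mul0r// => q _.
    by rewrite !mxE (negbTE pl) andbF mulr0.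
  rewrite addr0 !mxE (bigD1 k) //= big1 => [|q qk].
    by rewrite addr0 !mxE !eqxx mulr1.
  by rewrite !mxE (negbTE qk) mulr0.
rewrite /monom -scalemxAr -scalemxAl mulmxDr mulmxDl !mxE.
move: (delta_form i j) (delta_form j i); rewrite !mxE => -> ->.
rewrite [x 0 j * x 0 i]mulrC -[x 0 i * _ + _]mulr2n mulrnAr -mulrnAl.
by rewrite -[_^-1 *+ 2]mulr_natr mulVf ?mul1r ?pnatr_eq0.
Qed.

Section Webs.
Variable K : numFieldType.

Local Notation a := (@Ordinal 4 0 isT).
Local Notation b := (@Ordinal 4 1 isT).
Local Notation c := (@Ordinal 4 2 isT).
Local Notation d := (@Ordinal 4 3 isT).
Local Notation "i ** j" := (monom K i j) (at level 40).
Local Notation web := {vspace 'M[K]_4}.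

Definition A1_0001 : web := <<[:: a ** a; b ** b; c ** c; d ** d]>>.
Definition A2_0101 : web := <<[:: a ** a; b ** b; c ** d; c ** c]>>.
Definition A3_0101 : web := <<[:: a ** b; a ** a; c ** d; c ** c]>>.
Definition A4_1001 : web :=
  <<[:: a ** a; 2 *: (b ** d) + c ** c; b ** c; b ** b]>>.
Definition A5_0001 : web :=
  <<[:: a ** d + b ** c; 2 *: (a ** c) + b ** b; a ** b; a ** a]>>.
Definition B1_21 : web := <<[:: a ** a + b ** b; c ** c; d ** d; c ** d]>>.
Definition C1_1 : web :=
  <<[:: a ** a + b ** b; c ** c + d ** d;
        a ** c + b ** d; a ** d - b ** c]>>.
Definition E1_41 : web :=
  <<[:: 2 *: (a ** c) + d ** d; b ** b; a ** b; a ** a]>>.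
Definition E1_42 : web := <<[:: a ** c; b ** b + d ** d; a ** b; a ** a]>>.
Definition E2_4 : web := <<[:: a ** b; c ** d; a ** c; a ** a]>>.
Definition E3_4 : web :=
  <<[:: 2 *: (a ** c) + b ** b + d ** d; a ** d; a ** b; a ** a]>>.
Definition F_4 : web := <<[:: a ** d + b ** c; a ** a; b ** b; a ** b]>>.

End Webs.

(* Main.v *)
Require Import Defs.
From HB Require Import structures.
From mathcomp Require Import all_boot all_order all_algebra complex.
From mathcomp Require Import all_classical all_reals all_analysis.
From mathcomp Require Import ring.

Set Implicit Arguments.
Unset Strict Implicit.
Unset Printing Implicit Defensive.

Import GRing.Theory Num.Theory.
Import numFieldNormedType.Exports.

Local Open Scope classical_set_scope.
Local Open Scope ring_scope.

(** A degeneration is a one-parameter family of changes of variables under which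
    the transformed web converges to another web. On quadratic forms it amounts
    to a substitution of linear forms in [a, b, c, d] with coefficients in
    [K[t]], a recombination of the four resulting forms, and, for each
    combination, its lowest power of [t]: the coefficient there is a generator
    of the limit web. Both the substitution and the recombination must be
    invertible over the Laurent polynomials, which holds because each has a
    polynomial inverse up to a monomial in [t] ([GL_laurent_cert]).
    [degenerates_subst] turns such data into a degeneration of matrices: a
    symmetric matrix is determined by its quadratic form, by polarization, even
    modulo a power of [t] ([dvdp_qform]), so every claim about congruent
    matrices becomes an identity between polynomials.

    The first five substitutions have a common source. Putting
    [f(s) = (a + s b + s^2 c + s^3 d)^2], the web [A5] is spanned by the Taylor coefficients of [f] at 0 up
    to order 3. The webs [A1], ..., [A4] correspond to interpolation at several
    points with multiplicities 1+1+1+1, 2+1+1, 2+2 and 3+1, and their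
    degenerations are collisions of points. The remaining families scale some
    variables so that chosen terms dominate, and cancel the leading terms of the
    others.

    That each of the twelve spans is a Jordan web follows from
    [jordan_space_span]: each contains an involution [U], and for such a [U]
    closure under the Jordan product means that [X U X] stays in the web. *)

(** * Quadratic forms of matrices *)

Section QuadraticForms.
Variables (A : comNzRingType) (n : nat).
Implicit Types (x y : 'rV[A]_n) (M N : 'M[A]_n).

Definition qform x M : A := (x *m M *m x^T) 0 0.

Lemma qformD x M N : qform x (M + N) = qform x M + qform x N.
Proof. by rewrite /qform mulmxDr mulmxDl mxE. Qed.

Lemma qformN x M : qform x (- M) = - qform x M.
Proof. by rewrite /qform mulmxN mulNmx mxE. Qed.

Lemma qformZ x k M : qform x (k *: M) = k * qform x M.
Proof. by rewrite /qform -scalemxAr -scalemxAl mxE. Qed.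

Lemma qform_sum x I (r : seq I) (F : I -> 'M[A]_n) :
  qform x (\sum_(i <- r) F i) = \sum_(i <- r) qform x (F i).
Proof. by rewrite /qform mulmx_sumr mulmx_suml summxE. Qed.

Lemma qform_congr x (P M : 'M[A]_n) :
  qform x (P *m M *m P^T) = qform (x *m P) M.
Proof. by rewrite /qform trmx_mul !mulmxA. Qed.

Lemma qform_delta i M : qform (delta_mx 0 i) M = M i i.
Proof. by rewrite /qform trmx_delta -rowE -colE !mxE. Qed.

(** Polarization: the form on a sum of two basis vectors sees the off-diagonal
    entry of a symmetric matrix, twice. *)
Lemma qform_deltaD i j M : M^T = M ->
  qform (delta_mx 0 i + delta_mx 0 j) M = M i i + M j j + 2 * M i j.
Proof.
move=> sM; have Mji : M j i = M i j by rewrite -[in LHS]sM mxE.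
rewrite /qform linearD /= !trmx_delta mulmxDl mulmxDr !mulmxDl -!rowE -!colE.
by rewrite !mxE Mji; ring.
Qed.

End QuadraticForms.

Section FormIdentities.
Variables (K : numFieldType) (n : nat).

Lemma qform_inj (M N : 'M[K]_n) : M^T = M -> N^T = N ->
  (forall x, qform x M = qform x N) -> M = N.
Proof.
move=> sM sN eqMN; apply/matrixP => i j.
have := eqMN (delta_mx 0 i + delta_mx 0 j).
rewrite !qform_deltaD // -(qform_delta i M) -(qform_delta j M) !eqMN.
rewrite !qform_delta => /addrI /mulfI; apply.
by rewrite pnatr_eq0.
Qed.

(** Polarization recovers twice an entry, and 2 is a unit, so divisibility of
    all values of a form by [e] passes to the entries of its matrix. This is how
    a congruence between forms modulo a power of ['X] yields a congruence
    between matrices. *)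
Lemma dvdp_qform (e : {poly K}) (M : 'M[{poly K}]_n) : M^T = M ->
  (forall x, e %| qform x M) -> forall i j, e %| M i j.
Proof.
move=> sM eM i j.
have dg k : e %| M k k by rewrite -qform_delta.
have := eM (delta_mx 0 i + delta_mx 0 j).
rewrite qform_deltaD // dvdp_addr ?dvdp_add // -scaler_nat -mul_polyC.
by rewrite mul_polyC -scalerAl mul1r dvdpZr // pnatr_eq0.
Qed.

Lemma qform_monomE (x : 'rV[K]_n) i j : qform x (monom K i j) = x 0 i * x 0 j.
Proof. exact: qform_monom. Qed.

Lemma qform_map_monom (x : 'rV[{poly K}]_n) i j :
  qform x (map_mx polyC (monom K i j)) = x 0 i * x 0 j.
Proof.
have delta_form (k l : 'I_n) : qform x (delta_mx k l) = x 0 k * x 0 l.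
  rewrite /qform -(mul_delta_mx (0 : 'I_1)) mulmxA -mulmxA -[delta_mx 0 l]trmxK.
  by rewrite -trmx_mul trmx_delta -!colE [LHS]mxE big_ord1 !mxE.
rewrite /monom map_mxZ map_mxD !map_delta_mx qformZ qformD !delta_form.
have half : (2^-1)%:P * 2 = 1 :> {poly K}.
  by rewrite -polyC_natr -polyCM mulVf ?pnatr_eq0.
by rewrite /=; ring: half.
Qed.

Lemma qform_mapD (x : 'rV[{poly K}]_n) (M N : 'M[K]_n) :
  qform x (map_mx polyC (M + N)) =
    qform x (map_mx polyC M) + qform x (map_mx polyC N).
Proof. by rewrite map_mxD qformD. Qed.

Lemma qform_mapN (x : 'rV[{poly K}]_n) (M : 'M[K]_n) :
  qform x (map_mx polyC (- M)) = - qform x (map_mx polyC M).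
Proof. by rewrite map_mxN qformN. Qed.

Lemma qform_mapZ (x : 'rV[{poly K}]_n) k (M : 'M[K]_n) :
  qform x (map_mx polyC (k *: M)) = k%:P * qform x (map_mx polyC M).
Proof. by rewrite map_mxZ qformZ. Qed.

End FormIdentities.

(** * Jordan spaces given by a basis *)

Lemma mulmx1_invmx (A : comUnitRingType) n (M N : 'M[A]_n) :
  M *m N = 1%:M -> M \in unitmx /\ invmx M = N.
Proof.
move=> MN; have [Munit _] := mulmx1_unit MN.
by split=> //; rewrite -[RHS](mulKmx Munit) MN mulmx1.
Qed.

Section Jordan.
Variables (K : numFieldType) (n m : nat).

Definition span_comb (s : m.-tuple 'M[K]_n) (k : 'I_m -> K) : 'M[K]_n :=
  \sum_(i < m) k i *: tnth s i.

Lemma span_combP (s : m.-tuple 'M[K]_n) X :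
  reflect (exists k, X = span_comb s k) (X \in << s >>%VS).
Proof.
apply: (iffP idP) => [/coord_span ->|[k ->]].
  exists (fun i => coord s i X).
  by apply: eq_bigr => i _; rewrite (tnth_nth 0).
apply: rpred_sum => i _; apply: rpredZ; apply: memv_span; exact: mem_tnth.
Qed.

Lemma span_comb_sym (s : m.-tuple 'M[K]_n) k :
  (forall i, (tnth s i)^T = tnth s i) -> (span_comb s k)^T = span_comb s k.
Proof.
move=> sym; rewrite /span_comb linear_sum /=; apply: eq_bigr => i _.
by rewrite linearZ /= sym.
Qed.

(** When the unit [U] is an involution it is its own inverse, so the Jordan
    square of [X] is [X U X]. Polarization in [X] reduces closure under the
    product to closure under squares, and the form of [X U X] at [x] is the form
    of [U] at [x X]. *)
Lemma jordan_space_span (s : m.-tuple 'M[K]_n) (u : 'I_m -> K) :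
    (forall i, (tnth s i)^T = tnth s i) ->
    span_comb s u *m span_comb s u = 1%:M ->
    (forall k, exists z, forall x,
      qform (x *m span_comb s k) (span_comb s u) = qform x (span_comb s z)) ->
  jordan_space << s >>%VS.
Proof.
set U := span_comb s u => sym UU sqr; have symc := span_comb_sym _ sym.
have [Uunit UV] := mulmx1_invmx UU.
split=> [X /span_combP[k ->] //|]; exists U; split=> //.
  by apply/span_combP; exists u.
have sqrL X : X \in << s >>%VS -> X *m U *m X \in << s >>%VS.
  move=> /span_combP[k ->]; have [z zE] := sqr k.
  apply/span_combP; exists z; apply: qform_inj => //.
    by rewrite !trmx_mul !symc mulmxA.
  by move=> x; rewrite -zE -qform_congr symc.
move=> X Y XL YL; rewrite /jordan_prod UV.
have -> : X *m U *m Y + Y *m U *m X =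
    (X + Y) *m U *m (X + Y) - X *m U *m X - Y *m U *m Y.
  rewrite !mulmxDl !mulmxDr -!mulmxA.
  move: (X *m (U *m Y)) (Y *m (U *m X)) (X *m (U *m X)) (Y *m (U *m Y)).
  by move=> p q r t; apply/matrixP => i j; rewrite !mxE; ring.
by rewrite rpredZ // !rpredB // sqrL ?rpredD.
Qed.

Definition jordan_basis (s : m.-tuple 'M[K]_n) : Prop :=
  jordan_space << s >>%VS /\ free s.

Lemma free_pivots (s : m.-tuple 'M[K]_n) (p : 'I_m -> 'I_n * 'I_n) :
  (forall i j, (tnth s i (p j).1 (p j).2 == 0) = (i != j)) -> free s.
Proof.
move=> piv; apply/freeP => k sum0 j.
have := congr1 (fun M : 'M[K]_n => M (p j).1 (p j).2) sum0.
rewrite summxE (bigD1 j) //= big1 ?addr0 => [|i ij]; last first.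
  rewrite mxE -tnth_nth; move: (piv i j); rewrite ij => /eqP ->.
  by rewrite mulr0.
by rewrite !mxE -tnth_nth => /eqP; rewrite mulf_eq0 piv eqxx orbF => /eqP.
Qed.

End Jordan.

(** * Laurent matrices and limits at zero *)

Section Laurent.
Variable K : numFieldType.

Lemma is_laurent_div (p : {poly K}) c k : c != 0 ->
  is_laurent (tofrac p / tofrac (c *: 'X^k)).
Proof.
move=> c0; have C0 : tofrac c%:P != 0 :> {fraction {poly K}}.
  by rewrite tofrac_eq0 polyC_eq0.
have CV : tofrac (c^-1)%:P = (tofrac c%:P)^-1 :> {fraction {poly K}}.
  by apply: (mulfI C0); rewrite -rmorphM -polyCM !mulfV // rmorph1.
exists (c^-1 *: p), k; rewrite -!mul_polyC !rmorphM /= CV invfM.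
by rewrite mulrCA mulrA.
Qed.

Lemma GL_laurent_inverse n (M N : 'M[{fraction {poly K}}]_n) : M *m N = 1%:M ->
  (forall i j, is_laurent (M i j)) -> (forall i j, is_laurent (N i j)) ->
  GL_laurent M.
Proof.
move=> MN LM LN; have [Munit invM] := mulmx1_invmx MN.
by split; [exact: Munit | exact: LM | rewrite invM; exact: LN].
Qed.

Lemma cvg_map_horner0 n (Y : 'M[{poly K}]_n) (M : 'M[K]_n) :
  (forall i j, (Y i j).[0] = M i j) ->
  map_mx (fun p : {poly K} => p.[t]) Y @[t --> (0 : K)^'] --> M.
Proof.
move=> YM; apply/cvg_mx_entourageP => B entB.
have horner_cvg (p : {poly K}) : p.[t] @[t --> (0 : K)^'] --> p.[0].
  elim/poly_ind: p => [|p c IH].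
    rewrite horner0; under eq_fun do rewrite horner0.
    exact: cvg_cst.
  rewrite hornerMXaddC; under eq_fun do rewrite hornerMXaddC.
  apply: cvgD; last exact: cvg_cst.
  by apply: cvgM => //; exact: cvg_within.
apply: filter_forall => i; apply: filter_forall => j.
have := horner_cvg (Y i j); rewrite YM => /cvg_entourageP /(_ B entB).
by rewrite !near_simpl; apply: filterS => t; rewrite mxE inE.
Qed.

End Laurent.

(** * Degenerations from congruences of quadratic forms *)

Section Criterion.
Variables (K : numFieldType) (n m : nat).
Local Notation frac := (@tofrac {poly K}).

Lemma natX_scale k c : 'X^k *+ c = c%:R *: 'X^k :> {poly K}.
Proof. by rewrite scaler_nat. Qed.

Lemma tofrac_natX_neq0 k c : (0 < c)%N -> frac ('X^k *+ c) != 0.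
Proof.
move=> c0; rewrite tofrac_eq0 natX_scale scaler_eq0 negb_or.
by rewrite pnatr_eq0 -lt0n c0 expf_eq0 polyX_eq0 andbF.
Qed.

(** A polynomial matrix with a polynomial cofactor [M'] whose product with it is
    a multiple of a power of the variable is invertible over the Laurent
    polynomials; dividing each column by a monomial keeps it so. *)
Lemma GL_laurent_cert r (M M' : 'M[{poly K}]_r) p a (k c : 'I_r -> nat) :
    (0 < a)%N -> (forall j, (0 < c j)%N) -> M *m M' = ('X^p *+ a)%:M ->
  GL_laurent (\matrix_(i, j) (frac (M i j) / frac ('X^(k j) *+ c j))).
Proof.
move=> a0 c0 MM'; set d := 'X^p *+ a in MM'.
pose e j : {poly K} := 'X^(k j) *+ c j.
have e0 j : frac (e j) != 0 by exact: tofrac_natX_neq0.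
have d0 : frac d != 0 by exact: tofrac_natX_neq0.
pose N := \matrix_(i, j) (frac (e i * M' i j) / frac d).
apply: (@GL_laurent_inverse _ _ _ N).
- apply/matrixP => i j; rewrite !mxE.
  under eq_bigr => l _.
    rewrite !mxE rmorphM /= -/(e l) mulrA mulrA divfK; last exact: e0.
    rewrite -rmorphM; over.
  rewrite -mulr_suml -rmorph_sum /=.
  have -> : \sum_(l < r) M i l * M' l j = d *+ (i == j).
    by move: MM' => /matrixP /(_ i j); rewrite !mxE.
  by rewrite rmorphMn /= mulrnAl divff.
- move=> i j; rewrite mxE natX_scale; apply: is_laurent_div.
  by rewrite pnatr_eq0 -lt0n c0.
- move=> i j; rewrite mxE /d natX_scale; apply: is_laurent_div.
  by rewrite pnatr_eq0 -lt0n.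
Qed.

(** Congruence by [P] replaces the argument [x] of a form by [x P]. If the forms
    of the first web, transformed by [P] and combined by [Q], equal up to higher
    powers of ['X] a monomial times the forms of the second web, then dividing
    column [j] of [Q] by its monomial leaves polynomial matrices whose values at
    0 are the second basis. *)
Lemma degenerates_subst (s s' : m.-tuple 'M[K]_n) (P P' : 'M[{poly K}]_n)
    (Q Q' : 'M[{poly K}]_m) p q a b (k c : 'I_m -> nat) :
    jordan_basis s -> jordan_basis s' ->
    (0 < a)%N -> (0 < b)%N -> (forall j, (0 < c j)%N) ->
    P *m P' = ('X^p *+ a)%:M -> Q *m Q' = ('X^q *+ b)%:M ->
    (forall j x, 'X^((k j).+1) %|
      \sum_(i < m) Q i j * qform (x *m P) (map_mx polyC (tnth s i))
        - 'X^(k j) *+ c j * qform x (map_mx polyC (tnth s' j))) ->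
  degenerates m << s >>%VS << s' >>%VS.
Proof.
move=> [jL fs] [jL' fs'] a0 b0 c0 PP' QQ' dvdE.
have sym_s i : (tnth s i)^T = tnth s i.
  by apply: jL.1; apply: memv_span; exact: mem_tnth.
have sym_s' i : (tnth s' i)^T = tnth s' i.
  by apply: jL'.1; apply: memv_span; exact: mem_tnth.
pose S j := \sum_(i < m) Q i j *: (P *m map_mx polyC (tnth s i) *m P^T).
pose X' j := map_mx polyC (tnth s' j).
pose D j : {poly K} := 'X^(k j) *+ c j.
pose E j := S j - D j *: X' j.
have symS j : (S j)^T = S j.
  rewrite /S linear_sum /=; apply: eq_bigr => i _.
  by rewrite linearZ /= !trmx_mul trmxK map_trmx sym_s mulmxA.
have symE j : (E j)^T = E j.
  by rewrite /E linearB linearZ /= symS /X' map_trmx sym_s'.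
(* Symmetry lets the divisibility of the forms descend to the entries. *)
have dvd_entry j u v : 'X^((k j).+1) %| E j u v.
  apply: dvdp_qform => // x; rewrite qformD qformN qformZ qform_sum.
  by under eq_bigr do rewrite qformZ qform_congr; exact: dvdE.
pose Z j := \matrix_(u, v) (E j u v %/ 'X^((k j).+1)).
pose Y j := X' j + ((c j)%:R^-1)%:P *: ('X *: Z j).
have SY j : S j = D j *: Y j.
  rewrite -[LHS](subrK (D j *: X' j)) -/(E j) scalerDr addrC; congr (_ + _).
  apply/matrixP => u v; rewrite [LHS](esym (divpK (dvd_entry j u v))) !mxE.
  have cV : ((c j)%:R^-1)%:P * (c j)%:R = 1 :> {poly K}.
    by rewrite -polyC_natr -polyCM mulVf // pnatr_eq0 -lt0n.
  by rewrite /D; move: (_ %/ _) => r; rewrite -mulr_natl exprS; ring: cV.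
split=> //.
exists s, s', (map_mx frac P), (\matrix_(i, j) (frac (Q i j) / frac (D j))), Y.
split.
- by split; rewrite /basis_of eqxx.
(* P is the case of the certificate in which every column is divided by 1. *)
- have -> : map_mx frac P =
    \matrix_(i, j) (frac (P i j) / frac ('X^0 *+ 1)).
    by apply/matrixP => i j; rewrite !mxE expr0 mulr1n rmorph1 divr1.
  exact: (GL_laurent_cert _ a0 _ PP').
- exact: (GL_laurent_cert _ b0 _ QQ').
- move=> j.
  have D0 : frac (D j) != 0 by exact: tofrac_natX_neq0.
  have -> : map_mx frac (Y j) = (frac (D j))^-1 *: map_mx frac (S j).
    by rewrite SY map_mxZ scalerA mulVf // scale1r.
  rewrite /S map_mx_sum scaler_sumr; apply: eq_bigr => i _.
  rewrite map_mxZ scalerA mxE [_^-1 * _]mulrC; congr (_ *: _).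
  by rewrite !map_mxM -map_trmx -map_mx_comp.
- move=> j; apply: cvg_map_horner0 => u v.
  by rewrite !mxE !hornerE /= mulr0 mul0r addr0.
Qed.

End Criterion.

(** * Webs in four variables *)

Local Notation o0 := (@Ordinal 4 0 isT).
Local Notation o1 := (@Ordinal 4 1 isT).
Local Notation o2 := (@Ordinal 4 2 isT).
Local Notation o3 := (@Ordinal 4 3 isT).

Lemma forall_ord4 (T : 'I_4 -> Prop) :
  T o0 -> T o1 -> T o2 -> T o3 -> forall j, T j.
Proof.
move=> Ta Tb Tc Td [[|[|[|[|j]]]] jlt] //.
- by rewrite (_ : Ordinal jlt = o0) //; apply: val_inj.
- by rewrite (_ : Ordinal jlt = o1) //; apply: val_inj.
- by rewrite (_ : Ordinal jlt = o2) //; apply: val_inj.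
- by rewrite (_ : Ordinal jlt = o3) //; apply: val_inj.
Qed.

Lemma big_ord4 (V : nmodType) (F : 'I_4 -> V) :
  \sum_(i < 4) F i = F o0 + F o1 + F o2 + F o3.
Proof.
rewrite !big_ord_recl big_ord0 addr0 !addrA.
by congr (_ + _ + _ + _); congr F; apply: val_inj.
Qed.

Section Substitutions.
Variable A : comNzRingType.
Local Notation subst := (A -> A -> A -> A -> seq A).

Definition row4 (s : seq A) : 'rV[A]_4 := \row_j s`_j.

Definition app4 (T : Type) (L : A -> A -> A -> A -> T) (s : seq A) :=
  L s`_0 s`_1 s`_2 s`_3.

(** The matrix of a linear map of four variables written as the list of its
    coordinates, acting on row vectors. *)
Definition mx4 (L : subst) : 'M[A]_4 :=
  \matrix_(i, j)
    (L (i == o0)%:R (i == o1)%:R (i == o2)%:R (i == o3)%:R)`_j.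

Definition linear4 (L : subst) := forall (j : 'I_4) x y z w,
  (L x y z w)`_j =
    x * (L 1 0 0 0)`_j + y * (L 0 1 0 0)`_j + z * (L 0 0 1 0)`_j
      + w * (L 0 0 0 1)`_j.

(** The scalar [e] clears the denominators of the inverse of [L], so that over
    polynomials both maps have polynomial coefficients. *)
Definition inverse4 (L L' : subst) (e : A) := forall (j : 'I_4) x y z w,
  (app4 L' (L x y z w))`_j = e * [:: x; y; z; w]`_j.

Lemma row4_eta (x : 'rV[A]_4) : x = row4 [:: x 0 o0; x 0 o1; x 0 o2; x 0 o3].
Proof. by apply/rowP; apply: forall_ord4; rewrite mxE. Qed.

Lemma mul_row4 (L : subst) s : linear4 L -> row4 s *m mx4 L = row4 (app4 L s).
Proof.
by move=> linL; apply/rowP => j; rewrite !mxE big_ord4 !mxE [RHS]linL.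
Qed.

Lemma mul_mx4 (L L' : subst) (e : A) : linear4 L -> linear4 L' ->
  inverse4 L L' e -> mx4 L *m mx4 L' = e%:M.
Proof.
move=> linL linL' LL'; apply/row_matrixP => i.
rewrite !rowE mul_mx_scalar mulmxA.
rewrite [delta_mx _ _]row4_eta !mul_row4 //.
apply/rowP; apply: forall_ord4; rewrite !mxE; exact: LL'.
Qed.

End Substitutions.

Section Webs.
Variable K : numFieldType.
Local Notation form X s := (qform (row4 s) (map_mx polyC X)).

(** The data of a degeneration in four variables: [L] is the substitution of
    variables, [Q] the recombination of the transformed forms, [L'] and [Q']
    their inverses up to monomials, [e] and [h] the exponents and coefficients
    of the leading monomials, and [r] the remaining terms, which vanish at 0. *)
Lemma degenerates_web (s s' : 4.-tuple 'M[K]_4)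
    (L L' : {poly K} -> {poly K} -> {poly K} -> {poly K} -> seq {poly K})
    (Q Q' r : {poly K} -> {poly K} -> {poly K} -> {poly K} -> seq {poly K})
    p m q n (e h : seq nat) :
    jordan_basis s -> jordan_basis s' ->
    (0 < m)%N -> (0 < n)%N -> (forall j : 'I_4, (0 < nth 0 h j)%N) ->
    linear4 L -> linear4 L' -> inverse4 L L' ('X^p *+ m) ->
    linear4 Q -> linear4 Q' -> inverse4 Q Q' ('X^q *+ n) ->
    (forall (j : 'I_4) x y z w,
      (app4 Q [seq form X (L x y z w) | X <- s])`_j =
        'X^(nth 0%N e j) * (form (tnth s' j) [:: x; y; z; w] *+ nth 0%N h j
                     + 'X * (r x y z w)`_j)) ->
  degenerates 4 << s >>%VS << s' >>%VS.
Proof.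
move=> js js' m0 n0 l0 linL linL' LL' linQ linQ' QQ' lim.
apply: (degenerates_subst js js' m0 n0 l0 (mul_mx4 linL linL' LL')
  (mul_mx4 linQ linQ' QQ')) => j x.
set x4 := [:: x 0 o0; x 0 o1; x 0 o2; x 0 o3]; rewrite [x]row4_eta -/x4.
rewrite mul_row4 //; set y := app4 L x4.
have -> : \sum_(i < 4) mx4 Q i j * form (tnth s i) y =
    (app4 Q [seq form X y | X <- s])`_j.
  transitivity ((row4 [seq form X y | X <- s] *m mx4 Q) 0 j).
    rewrite [RHS]mxE; apply: eq_bigr => i _; rewrite [RHS]mulrC; congr (_ * _).
    by rewrite mxE (nth_map 0) ?size_tuple // -tnth_nth.
  by rewrite mul_row4 // mxE.
rewrite lim; apply/dvdpP; exists (app4 r x4)`_j.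
by rewrite exprS; ring.
Qed.

Lemma mul_row_monom n (x : 'rV[K]_n) i j l :
  (x *m monom K i j) 0 l = 2^-1 * (x 0 i * (j == l)%:R + x 0 j * (i == l)%:R).
Proof.
have mul_delta u v : (x *m delta_mx u v) 0 l = x 0 u * (v == l)%:R.
  rewrite -(mul_delta_mx (0 : 'I_1)) mulmxA -colE !mxE big_ord1 !mxE.
  by rewrite eqxx [l == v]eq_sym.
by rewrite /monom -scalemxAr mulmxDr mxE [X in _ * X]mxE !mul_delta.
Qed.

Lemma mul_rowD n (x : 'rV[K]_n) (M N : 'M[K]_n) l :
  (x *m (M + N)) 0 l = (x *m M) 0 l + (x *m N) 0 l.
Proof. by rewrite mulmxDr mxE. Qed.

Lemma mul_rowN n (x : 'rV[K]_n) (M : 'M[K]_n) l :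
  (x *m (- M)) 0 l = - (x *m M) 0 l.
Proof. by rewrite mulmxN mxE. Qed.

Lemma mul_rowZ n (x : 'rV[K]_n) k (M : 'M[K]_n) l :
  (x *m (k *: M)) 0 l = k * (x *m M) 0 l.
Proof. by rewrite -scalemxAr mxE. Qed.

Lemma trmx_add n (M N : 'M[K]_n) : (M + N)^T = M^T + N^T.
Proof. exact: linearD. Qed.

Lemma trmx_opp n (M : 'M[K]_n) : (- M)^T = - M^T.
Proof. exact: linearN. Qed.

Lemma trmx_scale n k (M : 'M[K]_n) : (k *: M)^T = k *: M^T.
Proof. exact: linearZ. Qed.

(** A web is verified on its generators: [u] gives a unit that is an involution,
    [z] the coordinates of the square of the element with coordinates [k], and
    [piv] for each generator a matrix position where it alone is nonzero. *)
Lemma jordan_basis4 (s : 4.-tuple 'M[K]_4) (u : seq K)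
    (z : K -> K -> K -> K -> seq K) (piv : seq ('I_4 * 'I_4)) :
    (forall i, (tnth s i)^T = tnth s i) ->
    (forall (x : 'rV_4) i, (x *m span_comb s (nth 0 u) *m
       span_comb s (nth 0 u)) 0 i = x 0 i) ->
    (forall k (x : 'rV_4), qform (x *m span_comb s k) (span_comb s (nth 0 u)) =
       qform x (span_comb s (nth 0 (z (k o0) (k o1) (k o2) (k o3))))) ->
    (forall i j : 'I_4,
       (tnth s i (nth (o0, o0) piv j).1 (nth (o0, o0) piv j).2 == 0)
         = (i != j)) ->
  jordan_basis s.
Proof.
move=> sym invU sqr pivP; split; last exact: free_pivots pivP.
apply: (@jordan_space_span _ _ _ s (fun i => u`_i)) => //.
  apply/row_matrixP => i; apply/rowP => j.
  by rewrite !rowE mulmxA mulmx1 invU.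
move=> k; exists (fun i => (z (k o0) (k o1) (k o2) (k o3))`_i) => x.
exact: sqr.
Qed.

End Webs.

(* A monomial matrix is itself a scaled matrix up to unfolding, so the rule for
   monomials must come before the rule for scalings. *)
Ltac expand_mul := rewrite !(mul_rowD, mul_rowN, mul_row_monom, mul_rowZ).

Ltac expand_comb :=
  rewrite /span_comb !big_ord4 !(tnth_nth 0) /=
    ?(scale0r, scale1r, addr0, add0r).

Ltac check_symmetric :=
  apply: forall_ord4; rewrite (tnth_nth 0) /=
    ?(trmx_add, trmx_opp, trmx_scale, monom_sym); reflexivity.

(* The inner product is abstracted so that each factor is expanded only once. *)
Ltac check_involution :=
  let x := fresh "x" in let i := fresh "i" in
  let y := fresh "y" in let Ey := fresh "Ey" in
  move=> x i; expand_comb; move Ey: (x *m _) => y; expand_mul;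
  rewrite -!Ey; expand_mul; move: i; by apply: forall_ord4; rewrite /=; field.

Ltac check_squares :=
  let k := fresh "k" in let x := fresh "x" in
  move=> k x; expand_comb; rewrite !(qformD, qformN, qform_monomE, qformZ);
  expand_mul; rewrite /=; by field.

Ltac check_pivots :=
  apply: forall_ord4; apply: forall_ord4; rewrite (tnth_nth 0) /= !mxE /=;
  rewrite ?(addr0, add0r, mulr0, oppr0) -?mulr2n;
  by rewrite ?(mulf_eq0, oppr_eq0, invr_eq0, pnatr_eq0, oner_eq0, eqxx).

Ltac expand_forms :=
  rewrite /app4 /= ?(tnth_nth 0) /=
    !(qform_mapD, qform_mapN, qform_map_monom, qform_mapZ) !mxE /= ?polyC_natr.

Ltac degeneration_check_with close := first
  [ by []
  | by apply: forall_ord4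
  | apply: forall_ord4 => ? ? ? ? /=; by close ()
  | apply: forall_ord4 => ? ? ? ?; expand_forms; by close () ].

Ltac degeneration_check := degeneration_check_with ltac:(fun _ => ring).
Ltac degeneration_check_i ii :=
  degeneration_check_with ltac:(fun _ => ring: ii).

(** * The twelve webs *)

Section TwelveWebs.
Variable K : numFieldType.
Local Notation a := o0.
Local Notation b := o1.
Local Notation c := o2.
Local Notation d := o3.
Local Notation "i ** j" := (monom K i j) (at level 40).

Definition gens_A1 : 4.-tuple 'M[K]_4 :=
  [tuple a ** a; b ** b; c ** c; d ** d].

Lemma jordan_A1 : jordan_basis gens_A1.
Proof.
apply: (@jordan_basis4 K gens_A1 [:: 1; 1; 1; 1]
  (fun k0 k1 k2 k3 =>
    [:: k0 ^+ 2; k1 ^+ 2; k2 ^+ 2; k3 ^+ 2])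
  [:: (a, a); (b, b); (c, c); (d, d)]);
  [check_symmetric | check_involution | check_squares | check_pivots].
Qed.

Definition gens_A2 : 4.-tuple 'M[K]_4 :=
  [tuple a ** a; b ** b; c ** d; c ** c].

Lemma jordan_A2 : jordan_basis gens_A2.
Proof.
apply: (@jordan_basis4 K gens_A2 [:: 1; 1; 2; 0]
  (fun k0 k1 k2 k3 =>
    [:: k0 ^+ 2; k1 ^+ 2; k2 ^+ 2 / 2; k2 * k3])
  [:: (a, a); (b, b); (c, d); (c, c)]);
  [check_symmetric | check_involution | check_squares | check_pivots].
Qed.

Definition gens_A3 : 4.-tuple 'M[K]_4 :=
  [tuple a ** b; a ** a; c ** d; c ** c].

Lemma jordan_A3 : jordan_basis gens_A3.
Proof.
apply: (@jordan_basis4 K gens_A3 [:: 2; 0; 2; 0]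
  (fun k0 k1 k2 k3 =>
    [:: k0 ^+ 2 / 2; k0 * k1; k2 ^+ 2 / 2; k2 * k3])
  [:: (a, b); (a, a); (c, d); (c, c)]);
  [check_symmetric | check_involution | check_squares | check_pivots].
Qed.

Definition gens_A4 : 4.-tuple 'M[K]_4 :=
  [tuple a ** a; 2 *: (b ** d) + c ** c; b ** c; b ** b].

Lemma jordan_A4 : jordan_basis gens_A4.
Proof.
apply: (@jordan_basis4 K gens_A4 [:: 1; 1; 0; 0]
  (fun k0 k1 k2 k3 =>
    [:: k0 ^+ 2; k1 ^+ 2; 2 * k1 * k2; 2 * k1 * k3 + k2 ^+ 2 / 4])
  [:: (a, a); (b, d); (b, c); (b, b)]);
  [check_symmetric | check_involution | check_squares | check_pivots].
Qed.

Definition gens_A5 : 4.-tuple 'M[K]_4 :=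
  [tuple a ** d + b ** c; 2 *: (a ** c) + b ** b; a ** b; a ** a].

Lemma jordan_A5 : jordan_basis gens_A5.
Proof.
apply: (@jordan_basis4 K gens_A5 [:: 2; 0; 0; 0]
  (fun k0 k1 k2 k3 =>
    [:: k0 ^+ 2 / 2; k0 * k1; k0 * k2 + 2 * k1 ^+ 2; k0 * k3 + k1 * k2])
  [:: (a, d); (a, c); (a, b); (a, a)]);
  [check_symmetric | check_involution | check_squares | check_pivots].
Qed.

Definition gens_B1 : 4.-tuple 'M[K]_4 :=
  [tuple a ** a + b ** b; c ** c; d ** d; c ** d].

Lemma jordan_B1 : jordan_basis gens_B1.
Proof.
apply: (@jordan_basis4 K gens_B1 [:: 1; 1; 1; 0]
  (fun k0 k1 k2 k3 =>
    [:: k0 ^+ 2; k1 ^+ 2 + k3 ^+ 2 / 4; k2 ^+ 2 + k3 ^+ 2 / 4;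
        k1 * k3 + k2 * k3])
  [:: (a, a); (c, c); (d, d); (c, d)]);
  [check_symmetric | check_involution | check_squares | check_pivots].
Qed.

Definition gens_C1 : 4.-tuple 'M[K]_4 :=
  [tuple a ** a + b ** b; c ** c + d ** d; a ** c + b ** d; a ** d - b ** c].

Lemma jordan_C1 : jordan_basis gens_C1.
Proof.
apply: (@jordan_basis4 K gens_C1 [:: 1; 1; 0; 0]
  (fun k0 k1 k2 k3 =>
    [:: k0 ^+ 2 + k2 ^+ 2 / 4 + k3 ^+ 2 / 4;
        k1 ^+ 2 + k2 ^+ 2 / 4 + k3 ^+ 2 / 4; k0 * k2 + k1 * k2;
        k0 * k3 + k1 * k3])
  [:: (a, a); (c, c); (a, c); (a, d)]);
  [check_symmetric | check_involution | check_squares | check_pivots].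
Qed.

Definition gens_E41 : 4.-tuple 'M[K]_4 :=
  [tuple 2 *: (a ** c) + d ** d; b ** b; a ** b; a ** a].

Lemma jordan_E41 : jordan_basis gens_E41.
Proof.
apply: (@jordan_basis4 K gens_E41 [:: 1; 1; 0; 0]
  (fun k0 k1 k2 k3 =>
    [:: k0 ^+ 2; k1 ^+ 2; k0 * k2 + k1 * k2; 2 * k0 * k3 + k2 ^+ 2 / 4])
  [:: (a, c); (b, b); (a, b); (a, a)]);
  [check_symmetric | check_involution | check_squares | check_pivots].
Qed.

Definition gens_E42 : 4.-tuple 'M[K]_4 :=
  [tuple a ** c; b ** b + d ** d; a ** b; a ** a].

Lemma jordan_E42 : jordan_basis gens_E42.
Proof.
apply: (@jordan_basis4 K gens_E42 [:: 2; 1; 0; 0]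
  (fun k0 k1 k2 k3 =>
    [:: k0 ^+ 2 / 2; k1 ^+ 2; k0 * k2 / 2 + k1 * k2; k0 * k3 + k2 ^+ 2 / 4])
  [:: (a, c); (b, b); (a, b); (a, a)]);
  [check_symmetric | check_involution | check_squares | check_pivots].
Qed.

Definition gens_E2 : 4.-tuple 'M[K]_4 :=
  [tuple a ** b; c ** d; a ** c; a ** a].

Lemma jordan_E2 : jordan_basis gens_E2.
Proof.
apply: (@jordan_basis4 K gens_E2 [:: 2; 2; 0; 0]
  (fun k0 k1 k2 k3 =>
    [:: k0 ^+ 2 / 2; k1 ^+ 2 / 2; k0 * k2 / 2 + k1 * k2 / 2; k0 * k3])
  [:: (a, b); (c, d); (a, c); (a, a)]);
  [check_symmetric | check_involution | check_squares | check_pivots].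
Qed.

Definition gens_E3 : 4.-tuple 'M[K]_4 :=
  [tuple 2 *: (a ** c) + b ** b + d ** d; a ** d; a ** b; a ** a].

Lemma jordan_E3 : jordan_basis gens_E3.
Proof.
apply: (@jordan_basis4 K gens_E3 [:: 1; 0; 0; 0]
  (fun k0 k1 k2 k3 =>
    [:: k0 ^+ 2; 2 * k0 * k1; 2 * k0 * k2;
        2 * k0 * k3 + k1 ^+ 2 / 4 + k2 ^+ 2 / 4])
  [:: (a, c); (a, d); (a, b); (a, a)]);
  [check_symmetric | check_involution | check_squares | check_pivots].
Qed.

Definition gens_F4 : 4.-tuple 'M[K]_4 :=
  [tuple a ** d + b ** c; a ** a; b ** b; a ** b].

Lemma jordan_F4 : jordan_basis gens_F4.
Proof.
apply: (@jordan_basis4 K gens_F4 [:: 2; 0; 0; 0]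
  (fun k0 k1 k2 k3 =>
    [:: k0 ^+ 2 / 2; k0 * k1; k0 * k2; k0 * k3])
  [:: (a, d); (a, a); (b, b); (a, b)]);
  [check_symmetric | check_involution | check_squares | check_pivots].
Qed.

End TwelveWebs.

(** * The twelve degenerations *)

Section TwelveDegenerations.
Variable K : numFieldType.

(** Two points collide: the difference quotient of the squares of [c] and [c + t
    d] tends to the derivative [2cd]. *)
Lemma degenerates_A1_A2 :
  degenerates 4 (A1_0001 K) (A2_0101 K).
Proof.
apply: (degenerates_web
    (L := fun a b c d =>
      [:: a; b; c; c + 'X * d])
    (L' := fun a b c d =>
      [:: 'X * a; 'X * b; 'X * c; - c + d])
    (Q := fun q0 q1 q2 q3 =>
      [:: q0; q1; - q2 + q3; q2])
    (Q' := fun q0 q1 q2 q3 =>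
      [:: q0; q1; q3; q2 + q3])
    (r := fun a b c d =>
      [:: 0; 0; d ^+ 2; 0])
    (p := 1) (m := 1) (q := 0) (n := 1)
    (e := [:: 0; 0; 1; 0]) (h := [:: 1; 1; 2; 1])
    (jordan_A1 K) (jordan_A2 K)); degeneration_check.
Qed.

(** The collision of another pair of points, [a] and [a + t b]. *)
Lemma degenerates_A2_A3 :
  degenerates 4 (A2_0101 K) (A3_0101 K).
Proof.
apply: (degenerates_web
    (L := fun a b c d =>
      [:: a; a + 'X * b; c; d])
    (L' := fun a b c d =>
      [:: 'X * a; - a + b; 'X * c; 'X * d])
    (Q := fun q0 q1 q2 q3 =>
      [:: - q0 + q1; q0; q2; q3])
    (Q' := fun q0 q1 q2 q3 =>
      [:: q1; q0 + q1; q2; q3])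
    (r := fun a b c d =>
      [:: b ^+ 2; 0; 0; 0])
    (p := 1) (m := 1) (q := 0) (n := 1)
    (e := [:: 1; 0; 0; 0]) (h := [:: 2; 1; 1; 1])
    (jordan_A2 K) (jordan_A3 K)); degeneration_check.
Qed.

(** A point runs into a double point along a curve with velocity [c] and
    acceleration [d]. Subtracting the Taylor polynomial of order 1 of its square
    leaves the coefficient of order 2. *)
Lemma degenerates_A2_A4 :
  degenerates 4 (A2_0101 K) (A4_1001 K).
Proof.
apply: (degenerates_web
    (L := fun a b c d =>
      [:: a; b + 'X * c + 'X^2 * d; b; c])
    (L' := fun a b c d =>
      [:: 'X^2 * a; 'X^2 * c; 'X^2 * d; b - c - 'X * d])
    (Q := fun q0 q1 q2 q3 =>
      [:: q0; q1 - q3 - 2 * 'X * q2; q2; q3])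
    (Q' := fun q0 q1 q2 q3 =>
      [:: q0; q1 + q3 + 2 * 'X * q2; q2; q3])
    (r := fun a b c d =>
      [:: 0; 2 * c * d + 'X * d ^+ 2; 0; 0])
    (p := 2) (m := 1) (q := 0) (n := 1)
    (e := [:: 0; 2; 0; 0]) (h := [:: 1; 1; 1; 1])
    (jordan_A2 K) (jordan_A4 K)); degeneration_check.
Qed.

(** Two double points collide. With [f(s) = (a + s b + s^2 c + s^3 d)^2] the
    transformed forms are [f(0)], [f(t)] and half of [f'(0)] and [f'(t)]; the
    combinations are Hermite interpolation, which recovers the second and third
    Taylor coefficients of [f] from these four values up to higher powers of
    [t]. *)
Lemma degenerates_A3_A5 :
  degenerates 4 (A3_0101 K) (A5_0001 K).
Proof.
apply: (degenerates_web
    (L := fun a b c d =>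
      [:: a; b; a + 'X * b + 'X^2 * c + 'X^3 * d;
          b + 2 * 'X * c + 3 * 'X^2 * d])
    (L' := fun a b c d =>
      [:: 'X^3 * a; 'X^3 * b;
          - 3 * 'X * a + 3 * 'X * c - 2 * 'X^2 * b - 'X^2 * d;
          2 * a - 2 * c + 'X * b + 'X * d])
    (Q := fun q0 q1 q2 q3 =>
      [:: 2 * q1 - 2 * q3 + 2 * 'X * q0 + 2 * 'X * q2;
          - 3 * q1 + 3 * q3 - 4 * 'X * q0 - 2 * 'X * q2; q0; q1])
    (Q' := fun q0 q1 q2 q3 =>
      [:: 2 * 'X * q2; 2 * 'X * q3; 3 * q0 + 2 * q1 + 2 * 'X * q2;
          2 * 'X * q0 + 2 * 'X * q1 + 2 * 'X * q3 + 4 * 'X^2 * q2])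
    (r := fun a b c d =>
      [:: 4 * b * d + 2 * c ^+ 2 + 6 * 'X * c * d + 4 * 'X^2 * d ^+ 2;
          - 2 * 'X * b * d - 'X * c ^+ 2 - 4 * 'X^2 * c * d - 3 * 'X^3 * d ^+ 2;
          0; 0])
    (p := 3) (m := 1) (q := 1) (n := 2)
    (e := [:: 3; 2; 0; 0]) (h := [:: 2; 1; 1; 1])
    (jordan_A3 K) (jordan_A5 K)); degeneration_check.
Qed.

(** A point runs into a triple point. The triple point gives the Taylor
    coefficients of order 0, 1 and 2 of [f(s) = (a + s b + s^2 c + s^3 d)^2],
    and subtracting them from [f(t)] leaves the one of order 3. *)
Lemma degenerates_A4_A5 :
  degenerates 4 (A4_1001 K) (A5_0001 K).
Proof.
apply: (degenerates_web
    (L := fun a b c d =>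
      [:: a + 'X * b + 'X^2 * c + 'X^3 * d; a; b; c])
    (L' := fun a b c d =>
      [:: 'X^3 * b; 'X^3 * c; 'X^3 * d; a - b - 'X * c - 'X^2 * d])
    (Q := fun q0 q1 q2 q3 =>
      [:: q0 - q3 - 2 * 'X * q2 - 'X^2 * q1; q1; q2; q3])
    (Q' := fun q0 q1 q2 q3 =>
      [:: q0 + q3 + 2 * 'X * q2 + 'X^2 * q1; q1; q2; q3])
    (r := fun a b c d =>
      [:: 2 * b * d + c ^+ 2 + 2 * 'X * c * d + 'X^2 * d ^+ 2; 0; 0; 0])
    (p := 3) (m := 1) (q := 0) (n := 1)
    (e := [:: 3; 0; 0; 0]) (h := [:: 2; 1; 1; 1])
    (jordan_A4 K) (jordan_A5 K)); degeneration_check.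
Qed.

(** The form [b^2 + d^2] of the limit factors as [(b + i d) (b - i d)], which
    the substitution produces from [bc]. The square in [2ac + b^2] has higher
    order in [t] than the multiple of [a]; so this generator and [ab] tend to [a
    (b - i d)] and [a (b + i d)], which span [ab] and [ad]. *)
Lemma degenerates_A5_E3 (i : {poly K}) : i ^+ 2 = -1 ->
  degenerates 4 (A5_0001 K) (E3_4 K).
Proof.
move=> ii.
apply: (degenerates_web
    (L := fun a b c d =>
      [:: a; 'X * b + 'X * i * d; 'X * b - 'X * i * d; 2 * 'X^2 * c])
    (L' := fun a b c d =>
      [:: 2 * 'X^2 * a; 'X * b + 'X * c; d; - 'X * i * b + 'X * i * c])
    (Q := fun q0 q1 q2 q3 =>
      [:: q0; i * q1 - 2 * i * q2; q1 + 2 * q2; q3])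
    (Q' := fun q0 q1 q2 q3 =>
      [:: 4 * q0; - 2 * i * q1 + 2 * q2; i * q1 + q2; 4 * q3])
    (r := fun a b c d =>
      [:: 0; i * b ^+ 2 - 2 * b * d - i * d ^+ 2;
          b ^+ 2 + 2 * i * b * d - d ^+ 2; 0])
    (p := 2) (m := 2) (q := 0) (n := 4)
    (e := [:: 2; 1; 1; 0]) (h := [:: 1; 4; 4; 1])
    (jordan_A5 K) (jordan_E3 K)); degeneration_check_i ii.
Qed.

(** Scaling [c] and [d] down leaves only [b^2] in [2ac + b^2] and does not
    change [ad + bc] up to a factor. *)
Lemma degenerates_A5_F4 :
  degenerates 4 (A5_0001 K) (F_4 K).
Proof.
apply: (degenerates_web
    (L := fun a b c d =>
      [:: a; b; 'X * c; 'X * d])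
    (L' := fun a b c d =>
      [:: 'X * a; 'X * b; c; d])
    (Q := fun q0 q1 q2 q3 =>
      [:: q0; q3; q1; q2])
    (Q' := fun q0 q1 q2 q3 =>
      [:: q0; q2; q3; q1])
    (r := fun a b c d =>
      [:: 0; 0; 2 * a * c; 0])
    (p := 1) (m := 1) (q := 0) (n := 1)
    (e := [:: 1; 0; 0; 0]) (h := [:: 1; 1; 1; 1])
    (jordan_A5 K) (jordan_F4 K)); degeneration_check.
Qed.

(** The forms in [c] and [d] become all forms in the new [a] and [b]; so the
    leading term of [(a + t^2 c)^2] can be subtracted, which exposes [2ac]. *)
Lemma degenerates_B1_E41 :
  degenerates 4 (B1_21 K) (E1_41 K).
Proof.
apply: (degenerates_web
    (L := fun a b c d =>
      [:: a + 'X^2 * c; 'X * d; a; b])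
    (L' := fun a b c d =>
      [:: 'X^2 * c; 'X^2 * d; a - c; 'X * b])
    (Q := fun q0 q1 q2 q3 =>
      [:: q0 - q1; q2; q3; q1])
    (Q' := fun q0 q1 q2 q3 =>
      [:: q0 + q3; q3; q1; q2])
    (r := fun a b c d =>
      [:: 'X * c ^+ 2; 0; 0; 0])
    (p := 2) (m := 1) (q := 0) (n := 1)
    (e := [:: 2; 0; 0; 0]) (h := [:: 1; 1; 1; 1])
    (jordan_B1 K) (jordan_E41 K)); degeneration_check.
Qed.

(** Writing [z = a + i b], [w = a - i b], [u = c + i d] and [v = c - i d], this
    web is spanned by the products of [z] and [u] with [w] and [v]. The
    substitution makes [z, u] equal to [2a, 2b] and lets [w, v] converge to the
    same pair, with velocities [-2c, 2d]. The products then tend to the squares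
    and products of [2a, 2b], and the difference of the two mixed ones, divided
    by [t], to a multiple of [ad + bc]. *)
Lemma degenerates_C1_F4 (i : {poly K}) : i ^+ 2 = -1 ->
  degenerates 4 (C1_1 K) (F_4 K).
Proof.
move=> ii.
apply: (degenerates_web
    (L := fun a b c d =>
      [:: 2 * a - 'X * c; - 'X * i * c; 2 * b + 'X * d; 'X * i * d])
    (L' := fun a b c d =>
      [:: 'X * a + 'X * i * b; 'X * c + 'X * i * d; 2 * i * b; - 2 * i * d])
    (Q := fun q0 q1 q2 q3 =>
      [:: - i * q3; q0; q1; q2])
    (Q' := fun q0 q1 q2 q3 =>
      [:: q1; q2; q3; i * q0])
    (r := fun a b c d =>
      [:: 0; - 4 * a * c; 4 * b * d; 2 * a * d - 2 * b * c])
    (p := 1) (m := 2) (q := 0) (n := 1)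
    (e := [:: 1; 0; 0; 0]) (h := [:: 2; 4; 4; 4])
    (jordan_C1 K) (jordan_F4 K)); degeneration_check_i ii.
Qed.

(** Subtracting [b^2] from [(b + t^2 c)^2] exposes [2bc], of the same order in
    [t] as the transform [2 t^2 ad] of [2ac]. *)
Lemma degenerates_E41_F4 :
  degenerates 4 (E1_41 K) (F_4 K).
Proof.
apply: (degenerates_web
    (L := fun a b c d =>
      [:: a; b; 'X^2 * d; b + 'X^2 * c])
    (L' := fun a b c d =>
      [:: 'X^2 * a; 'X^2 * b; - b + d; c])
    (Q := fun q0 q1 q2 q3 =>
      [:: q0 - q1; q3; q1; q2])
    (Q' := fun q0 q1 q2 q3 =>
      [:: q0 + q2; q2; q3; q1])
    (r := fun a b c d =>
      [:: 'X * c ^+ 2; 0; 0; 0])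
    (p := 2) (m := 1) (q := 0) (n := 1)
    (e := [:: 2; 0; 0; 0]) (h := [:: 2; 1; 1; 1])
    (jordan_E41 K) (jordan_F4 K)); degeneration_check.
Qed.

(** The linear factors of [b^2 + d^2] become [2c] and [2td]; as the second one
    is small, [ab] tends to [ac]. *)
Lemma degenerates_E42_E2 (i : {poly K}) : i ^+ 2 = -1 ->
  degenerates 4 (E1_42 K) (E2_4 K).
Proof.
move=> ii.
apply: (degenerates_web
    (L := fun a b c d =>
      [:: a; c + 'X * d; b; - i * c + 'X * i * d])
    (L' := fun a b c d =>
      [:: 2 * 'X * a; 2 * 'X * c; 'X * b + 'X * i * d; b - i * d])
    (Q := fun q0 q1 q2 q3 =>
      [:: q0; q1; q2; q3])
    (Q' := fun q0 q1 q2 q3 =>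
      [:: q0; q1; q2; q3])
    (r := fun a b c d =>
      [:: 0; 0; a * d; 0])
    (p := 1) (m := 2) (q := 0) (n := 1)
    (e := [:: 0; 1; 0; 0]) (h := [:: 1; 4; 1; 1])
    (jordan_E42 K) (jordan_E2 K)); degeneration_check_i ii.
Qed.

(** The sum of [ab] and [cd] makes the terms [a (b - i d)] cancel and leaves [t
    (2ac + b^2 + d^2)]. The leading terms of [ab] and of [ac + a^2] are
    multiples of [a (b - i d)] and [a (b + i d)], whose span contains [ab] and
    [ad]. *)
Lemma degenerates_E2_E3 (i : {poly K}) : i ^+ 2 = -1 ->
  degenerates 4 (E2_4 K) (E3_4 K).
Proof.
move=> ii.
apply: (degenerates_web
    (L := fun a b c d =>
      [:: a; b - i * d + 2 * 'X * c; - a + 'X * b + 'X * i * d; b - i * d])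
    (L' := fun a b c d =>
      [:: 2 * 'X * a; a + c + 'X * d; b - d; - i * a - i * c + 'X * i * d])
    (Q := fun q0 q1 q2 q3 =>
      [:: q0 + q1; - i * q2 - i * q3 + 'X * i * q0; q2 + q3 + 'X * q0; q3])
    (Q' := fun q0 q1 q2 q3 =>
      [:: - i * q1 + q2; i * q1 - q2 + 2 * 'X * q0;
          'X * i * q1 + 'X * q2 - 2 * 'X * q3; 2 * 'X * q3])
    (r := fun a b c d =>
      [:: 0; 2 * i * a * c; 2 * a * c; 0])
    (p := 1) (m := 2) (q := 1) (n := 2)
    (e := [:: 1; 1; 1; 0]) (h := [:: 1; 2; 2; 1])
    (jordan_E2 K) (jordan_E3 K)); degeneration_check_i ii.
Qed.

End TwelveDegenerations.

Theorem propositionB5 (R : realType) :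
  let C := CC R in
  degenerates 4 (A1_0001 C) (A2_0101 C) /\
  degenerates 4 (A2_0101 C) (A3_0101 C) /\
  degenerates 4 (A2_0101 C) (A4_1001 C) /\
  degenerates 4 (A3_0101 C) (A5_0001 C) /\
  degenerates 4 (A4_1001 C) (A5_0001 C) /\
  degenerates 4 (A5_0001 C) (E3_4 C) /\
  degenerates 4 (A5_0001 C) (F_4 C) /\
  degenerates 4 (B1_21 C) (E1_41 C) /\
  degenerates 4 (C1_1 C) (F_4 C) /\
  degenerates 4 (E1_41 C) (F_4 C) /\
  degenerates 4 (E1_42 C) (E2_4 C) /\
  degenerates 4 (E2_4 C) (E3_4 C).
Proof.
move=> C; pose i : {poly C} := ('i%C : C)%:P.
have ii : i ^+ 2 = -1 by rewrite /i -polyC_exp (@sqr_i R) polyCN.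
split; first exact: degenerates_A1_A2.
split; first exact: degenerates_A2_A3.
split; first exact: degenerates_A2_A4.
split; first exact: degenerates_A3_A5.
split; first exact: degenerates_A4_A5.
split; first exact: degenerates_A5_E3 ii.
split; first exact: degenerates_A5_F4.
split; first exact: degenerates_B1_E41.
split; first exact: degenerates_C1_F4 ii.
split; first exact: degenerates_E41_F4.
split; first exact: degenerates_E42_E2 ii.
exact: degenerates_E2_E3 ii.
Qed.
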